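(* For an integer $t$ let $\mathcal{H}_t=\mathrm{Forb}(K_{2,t})$. For all $p\in[0,1]$: (i) $$\mathrm{ed}_{\mathcal{H}_5}(p)\leq\min\left\{p(1-p),\frac{1+75p}{96},\frac{1+26p}{40},\frac{1+5p}{13},\frac16,\frac{1-p}{4}\right\}.$$ (ii) $$\mathrm{ed}_{\mathcal{H}_6}(p)\leq\min\left\{p(1-p),\frac{1+63p}{85},\frac{1+14p}{26},\frac{1+7p}{17},\frac{1+2p}{10},\frac{1-p}{5}\right\}.$$ (iii) $$\mathrm{ed}_{\mathcal{H}_7}(p)\leq\min\left\{p(1-p),\frac{1+124p}{156},\frac{1+76p}{100},\frac{1+44p}{64},\frac{1+31p}{49},\frac{1+20p}{36},\frac{1+5p}{16},\frac18,\frac{1-p}{6}\right\}.$$ (iv) $$\mathrm{ed}_{\mathcal{H}_8}(p)\leq\min\left\{p(1-p),\frac{1+124p}{156},\frac{1+95p}{125},\frac{1+53p}{76},\frac{1+20p}{36},\frac{1+11p}{25},\frac{1+5p}{16},\frac{3p+1}{13},\frac{1-p}{7}\right\}.$$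
   Context: All graphs are finite and simple. $K_{2,t}$ is the complete bipartite graph with parts of sizes $2$ and $t$. For a graph $H$, $\mathrm{Forb}(H)$ is the hereditary property consisting of all graphs with no induced subgraph isomorphic to $H$. For graphs $G,G'$ on the same labeled vertex set, $\mathrm{dist}(G,G')=|E(G)\,\Delta\, E(G')|$; for a hereditary property $\mathcal{H}$ (a set of graphs closed under isomorphism and vertex deletion), $\mathrm{dist}(G,\mathcal{H})=\min\{\mathrm{dist}(G,G'): G'\in\mathcal{H},\ V(G')=V(G)\}$. The edit distance function is $$\mathrm{ed}_{\mathcal{H}}(p)=\lim_{n\to\infty}\max\left\{\mathrm{dist}(G,\mathcal{H}): |V(G)|=n,\ |E(G)|=\left\lfloor p\tbinom n2\right\rfloor\right\}\Big/\tbinom n2,\qquad p\in[0,1].$$ (The limit is known to exist, and the function is known to be continuous and concave.) *)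

(* Defs.v *)
(* MathComp + MathComp-Analysis *)
From HB Require Import structures.
From mathcomp Require Import all_boot all_order all_algebra.
From mathcomp Require Import all_classical all_reals all_analysis.

Set Implicit Arguments.
Unset Strict Implicit.
Unset Printing Implicit Defensive.

Import Order.TTheory GRing.Theory Num.Theory.
Import numFieldNormedType.Exports.

Local Open Scope nat_scope.

Record sgraph (V : finType) := SGraph {
  edges : {set {set V}};
  edgesP : [forall e in edges, #|e| == 2]
}.

HB.instance Definition _ (V : finType) := [isSub for @edges V].
HB.instance Definition _ (V : finType) := [Finite of sgraph V by <:].

Definition adj (V : finType) (G : sgraph V) (x y : V) : bool :=
  [set x; y] \in edges G.

Definition graph_iso (V W : finType) (G : sgraph V) (H : sgraph W) : Prop :=
  exists f : V -> W, bijective f /\ forall x y, adj G x y = adj H (f x) (f y).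

Definition induced_edges (V : finType) (G : sgraph V) (S : {set V}) :
    {set {set {x : V | x \in S}}} :=
  [set e : {set {x : V | x \in S}} | [set val x | x in e] \in edges G].

Lemma induced_edgesP (V : finType) (G : sgraph V) (S : {set V}) :
  [forall e in induced_edges G S, #|e| == 2].
Proof.
apply/forall_inP => e; rewrite inE => eG.
by have := forall_inP (edgesP G) _ eG; rewrite card_imset //; exact: val_inj.
Qed.

Definition induced (V : finType) (G : sgraph V) (S : {set V}) :
  sgraph {x : V | x \in S} := SGraph (induced_edgesP G S).

Lemma adj_induced (V : finType) (G : sgraph V) (S : {set V})
    (x y : {x : V | x \in S}) :
  adj (induced G S) x y = adj G (val x) (val y).
Proof. by rewrite /adj /= inE imsetU1 imset_set1. Qed.

Definition K2_edges (t : nat) : {set {set ('I_2 + 'I_t)%type}} :=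
  [set [set inl i; inr j] | i in 'I_2, j in 'I_t].

Lemma K2_edgesP (t : nat) : [forall e in K2_edges t, #|e| == 2].
Proof.
by apply/forall_inP => e /imset2P[i j _ _ ->]; rewrite cards2.
Qed.

Definition K2 (t : nat) : sgraph ('I_2 + 'I_t)%type := SGraph (K2_edgesP t).

Record hereditary_property := HereditaryProperty {
  has_property :> forall V : finType, sgraph V -> Prop;
  has_property_iso : forall (V W : finType) (G : sgraph V) (H : sgraph W),
    graph_iso G H -> has_property G -> has_property H;
  has_property_del : forall (V : finType) (G : sgraph V) (v : V),
    has_property G -> has_property (induced G [set~ v])
}.

Definition forb (U : finType) (F : sgraph U) (V : finType) (G : sgraph V) :
    Prop :=
  ~ exists S : {set V}, graph_iso F (induced G S).

Lemma induced_copyP (U V : finType) (F : sgraph U) (G : sgraph V) :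
  (exists S : {set V}, graph_iso F (induced G S)) <->
  (exists f : U -> V, injective f /\ forall x y, adj F x y = adj G (f x) (f y)).
Proof.
split=> [[S [f [bf fE]]]|[f [fI fE]]].
  exists (val \o f); split; first exact/inj_comp/bij_inj/bf/val_inj.
  by move=> x y; rewrite fE adj_induced.
pose S := [set f x | x in U].
have fS x : f x \in S by exact: imset_f.
pose g x : {x : V | x \in S} := exist _ (f x) (fS x).
exists S, g; split; last by move=> x y; rewrite fE adj_induced.
apply: inj_card_bij => [x y [] /fI //|].
by rewrite card_sig -(card_imset _ fI); apply/eq_leq/eq_card => x; rewrite !inE.
Qed.

Lemma forb_iso (U : finType) (F : sgraph U) (V W : finType)
    (G : sgraph V) (H : sgraph W) :
  graph_iso G H -> forb F G -> forb F H.
Proof.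
move=> [h [[k hK kK] hE]] FG /induced_copyP[f [fI fE]]; apply: FG.
apply/induced_copyP; exists (k \o f); split.
  exact: inj_comp (can_inj kK) fI.
by move=> x y; rewrite fE hE /= !kK.
Qed.

Lemma forb_del (U : finType) (F : sgraph U) (V : finType)
    (G : sgraph V) (v : V) :
  forb F G -> forb F (induced G [set~ v]).
Proof.
move=> FG /induced_copyP[f [fI fE]]; apply: FG; apply/induced_copyP.
exists (val \o f); split; first exact: inj_comp val_inj fI.
by move=> x y; rewrite fE adj_induced.
Qed.

Definition Forb (U : finType) (F : sgraph U) : hereditary_property :=
  HereditaryProperty (@forb_iso U F) (@forb_del U F).

Definition edit_dist (V : finType) (G G' : sgraph V) : nat :=
  #|(edges G :\: edges G') :|: (edges G' :\: edges G)|.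

Lemma edit_dist_le (V : finType) (G G' : sgraph V) :
  edit_dist G G' <= 'C(#|V|, 2).
Proof.
rewrite -card_draws; apply/subset_leq_card/fintype.subsetP => e.
rewrite !inE.
by case/orP => /andP[_]; [move/(forall_inP (edgesP G))
                         |move/(forall_inP (edgesP G'))].
Qed.

(* By edit_dist_le the default value of the minimum is neutral, so this is the
   exact minimum as soon as some graph on V has property P. *)
Definition dist_to (P : hereditary_property) (V : finType) (G : sgraph V) :
    nat :=
  \big[minn/'C(#|V|, 2)]_(G' : sgraph V | `[< P V G' >]) edit_dist G G'.

Definition max_dist (R : realType) (P : hereditary_property) (p : R)
    (n : nat) : nat :=
  \max_(G : sgraph 'I_n |
        (#|edges G|%:Z == Num.floor (p * 'C(n, 2)%:R))%R) dist_to P G.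

(* The limit is known to exist for p in [0, 1]; the terms with n < 2 are 0 / 0
   and do not matter. *)
Definition ed (R : realType) (P : hereditary_property) (p : R) : R :=
  limn (fun n : nat => ((max_dist P p n)%:R / 'C(n, 2)%:R)%R : R).

(* Main.v *)
Require Import Defs.
From HB Require Import structures.
From mathcomp Require Import all_boot all_order all_algebra.
From mathcomp Require Import all_classical all_reals all_analysis.
From mathcomp Require Import lra ring zify.

(* Colour the vertices of G at random by the vertices of a coloured regularity
   graph (CRG) and make every pair of vertices agree with the colour of the
   corresponding pair of the CRG (black: add the edge, white: delete it, gray:
   leave it). If the CRG receives no homomorphism from K_{2,t}, the outcome is
   K_{2,t}-free, and the expected number of edits bounds the distance. The
   bound p(1-p) comes from one white and one black vertex joined by a gray
   edge. All the other bounds come from k black vertices joined by gray and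
   white edges with equal weights: no K_{2,t} maps to such a CRG as soon as in
   the graph of gray edges two vertices have fewer than t common neighbours,
   and fewer than t-2 if they are adjacent. A d-regular such graph gives the
   line (1+(k-2-d)p)/k. Most lines come from known strongly regular graphs. The
   lines (1+31p)/49 (t = 7) and (1+53p)/76 (t = 8) would correspond to the
   parameters (49,16,3,6) and (76,21,2,7), for which there is no strongly
   regular graph; they follow from the neighbouring lines together with a graph
   on 68, respectively 72, vertices. The line (1+76p)/100 is implied by those
   of 156 and 64 vertices. *)

Set Implicit Arguments.
Unset Strict Implicit.
Unset Printing Implicit Defensive.

Import Order.TTheory GRing.Theory Num.Theory.
Import numFieldNormedType.Exports.

Local Open Scope ring_scope.

(** * Graphs from relations and recolouring *)

Definition rel_edges (V : finType) (e : rel V) : {set {set V}} :=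
  [set [set u.1; u.2] | u in [pred u : V * V | (u.1 != u.2) && e u.1 u.2]].

Lemma rel_edgesP (V : finType) (e : rel V) :
  [forall s in rel_edges e, #|s| == 2%N].
Proof.
by apply/forall_inP => s /imsetP[[x y] /andP[/= xy _] ->]; rewrite cards2 xy.
Qed.

Definition rel_graph (V : finType) (e : rel V) : sgraph V :=
  SGraph (rel_edgesP e).

Lemma set2_inj (V : finType) (x y a b : V) :
  [set x; y] = [set a; b] -> (x = a /\ y = b) \/ (x = b /\ y = a).
Proof.
move=> E.
have : x \in [set a; b] by rewrite -E set21.
have : y \in [set a; b] by rewrite -E set22.
have : a \in [set x; y] by rewrite E set21.
have : b \in [set x; y] by rewrite E set22.
rewrite !inE.
by do 4![case/orP => /eqP ?]; subst; auto.
Qed.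

Lemma adj_rel_graph (V : finType) (e : rel V) (x y : V) :
  symmetric e -> adj (rel_graph e) x y = (x != y) && e x y.
Proof.
move=> eC; apply/imsetP/andP => [[[a b]]|[xy exy]]; last first.
  by exists (x, y); rewrite ?inE ?xy.
rewrite inE /= => /andP[ab eab] /set2_inj[[-> ->]|[-> ->]] //.
by rewrite eq_sym eC.
Qed.

Lemma adj_irr (V : finType) (G : sgraph V) (x : V) : adj G x x = false.
Proof.
apply/negP => /(forall_inP (edgesP G)); by rewrite cards2 eqxx.
Qed.

Lemma adjC (V : finType) (G : sgraph V) : symmetric (adj G).
Proof. by move=> x y; rewrite /adj finset.setUC. Qed.

(* In a CRG the value None stands for gray, Some false for white and Some true
   for black; c i i is the colour of the vertex i. *)
Definition recolor (K V : finType) (c : K -> K -> option bool)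
    (G : sgraph V) (f : V -> K) : sgraph V :=
  rel_graph (fun x y => if c (f x) (f y) is Some b then b else adj G x y).

Lemma adj_recolor (K V : finType) (c : K -> K -> option bool)
    (G : sgraph V) (f : V -> K) (x y : V) :
  (forall i j, c i j = c j i) -> x != y ->
  adj (recolor c G f) x y =
  if c (f x) (f y) is Some b then b else adj G x y.
Proof.
move=> cC xy; rewrite adj_rel_graph ?xy // => a b.
by rewrite cC; case: (c _ _) => //; rewrite adjC.
Qed.

(** An induced copy of [F] followed by [f] is a map to the CRG; the pair whose colour disagrees with
    [F] contradicts the copy. *)
Lemma recolor_forb (U K V : finType) (F : sgraph U) (c : K -> K -> option bool)
    (G : sgraph V) (f : V -> K) :
  (forall i j, c i j = c j i) ->
  (forall g : U -> K,
     exists x y, x != y /\ c (g x) (g y) = Some (~~ adj F x y)) ->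
  forb F (recolor c G f).
Proof.
move=> cC cF /induced_copyP[g [gI gE]].
have [x [y [xy cxy]]] := cF (f \o g).
have := gE x y; rewrite adj_recolor ?(inj_eq gI) //.
by move: cxy; rewrite /= => ->; case: adj.
Qed.

(** * Expected number of edits *)

Lemma sum_prod_weight (R : realType) (K V : finType) (w : K -> R) :
  \sum_i w i = 1 -> \sum_(f : {ffun V -> K}) \prod_v w (f v) = 1.
Proof.
move=> w_sum; rewrite -(bigA_distr_bigA (fun (_ : V) i => w i)) /=.
by rewrite big1 // => v _; rewrite w_sum.
Qed.

Lemma expect_pair (R : realType) (K V : finType) (w : K -> R)
    (h : K -> K -> R) (x y : V) :
  \sum_i w i = 1 -> x != y ->
  \sum_(f : {ffun V -> K}) (\prod_v w (f v)) * h (f x) (f y) =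
  \sum_i \sum_j w i * w j * h i j.
Proof.
move=> w_sum xy; pose wf (f : {ffun V -> K}) := \prod_v w (f v).
have hE (f : {ffun V -> K}) : wf f * h (f x) (f y) =
   \sum_i \sum_j (wf f * (((f x == i)%:R * (f y == j)%:R)) * h i j).
  rewrite (bigD1 (f x)) //= (bigD1 (f y)) //= !eqxx !mulr1.
  rewrite big1 => [|j /negbTE jy]; last first.
    by rewrite [_ == j]eq_sym jy !mulr0 mul0r.
  rewrite addr0 big1 ?addr0 // => i /negbTE ix.
  by apply: big1 => j _; rewrite [_ == i]eq_sym ix mul0r mulr0 mul0r.
rewrite (eq_bigr _ (fun f _ => hE f)) exchange_big; apply: eq_bigr => i _ /=.
rewrite exchange_big; apply: eq_bigr => j _ /=.
rewrite -mulr_suml; congr (_ * _).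
(* The indicators of [f x = i] and [f y = j] are absorbed into the factors at [x] and [y], so the
   sum over [f] factorizes; the other factors sum to 1. *)
pose F v k := w k * ((v == x) ==> (k == i))%:R * ((v == y) ==> (k == j))%:R.
transitivity (\sum_(f : {ffun V -> K}) \prod_v F v (f v)).
  apply: eq_bigr => f _; rewrite /F !big_split /= -/(wf f) -mulrA.
  congr (_ * (_ * _)).
    by rewrite (bigD1 x) //= eqxx /= big1 ?mulr1 // => v /negbTE->.
  by rewrite (bigD1 y) //= eqxx /= big1 ?mulr1 // => v /negbTE->.
rewrite -(bigA_distr_bigA F) (bigD1 x) //= (bigD1 y) 1?eq_sym //=.
rewrite mulrA [X in _ * X = _]big1 ?mulr1 => [|v /andP[/negbTE vx /negbTE vy]]; last first.
  by rewrite -[RHS]w_sum; apply: eq_bigr => k _; rewrite /F vx vy !mulr1.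
congr (_ * _).
  rewrite (bigD1 i) //= big1 ?addr0 => [|k /negbTE ki].
    by rewrite /F (negbTE xy) !eqxx !mulr1.
  by rewrite /F eqxx ki mulr0 mul0r.
rewrite (bigD1 j) //= big1 ?addr0 => [|k /negbTE kj].
  by rewrite /F eq_sym (negbTE xy) !eqxx !mulr1.
by rewrite /F eqxx kj mulr0.
Qed.

(* The probability that a pair is coloured white (b = false) or black
   (b = true). *)
Definition crg_weight (R : realType) (K : finType) (c : K -> K -> option bool)
    (w : K -> R) (b : bool) : R :=
  \sum_i \sum_j w i * w j * (c i j == Some b)%:R.

Lemma dist_to_le_edit (P : hereditary_property) (V : finType)
    (G G' : sgraph V) : P V G' -> (dist_to P G <= edit_dist G G')%N.
Proof.
move=> PG'; rewrite /dist_to.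
have: G' \in index_enum (sgraph V : finType) by rewrite mem_index_enum.
elim: index_enum => //= H r IHr; rewrite inE big_cons.
case/orP => [/eqP <-|/IHr le_r]; first by rewrite asboolT // geq_minl.
by case: ifP => // _; apply: leq_trans le_r; exact: geq_minr.
Qed.

(** Linearity of expectation over pairs: an edge is edited exactly when its pair is coloured white,
    a non-edge exactly when it is coloured black. *)
Lemma expect_edit_dist (R : realType) (K V : finType)
    (c : K -> K -> option bool) (w : K -> R) (G : sgraph V) :
  (forall i j, c i j = c j i) -> \sum_i w i = 1 ->
  \sum_(f : {ffun V -> K}) (\prod_v w (f v)) *
      (edit_dist G (recolor c G f))%:R =
  #|edges G|%:R * crg_weight c w false +
  ('C(#|V|, 2)%:R - #|edges G|%:R) * crg_weight c w true.
Proof.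
move=> cC w1.
pose S := [set e : {set V} | #|e| == 2%N].
pose T (f : {ffun V -> K}) (e : {set V}) :=
  (e \in edges G) != (e \in edges (recolor c G f)).
have dE (f : {ffun V -> K}) :
    (edit_dist G (recolor c G f))%:R = \sum_(e in S) (T f e)%:R :> R.
  rewrite /edit_dist -sum1_card natr_sum big_mkcond [RHS]big_mkcond /=.
  apply: eq_bigr => e _; rewrite !inE /T.
  have := forall_inP (edgesP G) e.
  have := forall_inP (edgesP (recolor c G f)) e.
  case: (e \in edges G); case: (e \in edges _) => /= h1 h2.
  - by case: ifP.
  - by rewrite h2.
  - by rewrite h1.
  - by case: ifP.
rewrite (eq_bigr (fun f : {ffun V -> K} => \sum_(e in S)
    (\prod_v w (f v)) * (T f e)%:R)); last by move=> f _; rewrite dE mulr_sumr.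
rewrite exchange_big /= (bigID (fun e => e \in edges G)) /=.
have TE e : e \in S ->
    \sum_(f : {ffun V -> K}) (\prod_v w (f v)) * (T f e)%:R =
    crg_weight c w (e \notin edges G).
  rewrite inE => /cards2P[x [y [xy ->]]].
  rewrite /crg_weight -(expect_pair
    (fun i j => (c i j == Some ([set x; y] \notin edges G))%:R) w1 xy).
  apply: eq_bigr => f _; congr (_ * _%:R); rewrite /T.
  rewrite -/(adj _ x y) -/(adj _ x y) (adj_recolor _ _ cC xy).
  by case: (c _ _) => [[]|] /=; case: adj.
congr (_ + _).
  rewrite (eq_bigr (fun=> crg_weight c w false)); last first.
    by move=> e /andP[eS eG]; rewrite TE // eG.
  rewrite sumr_const -[LHS]mulr_natl; congr (_%:R * _).
  apply: eq_card => e; rewrite unfold_in inE.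
  by case eG: (e \in edges G); rewrite ?andbF // (forall_inP (edgesP G) _ eG).
rewrite (eq_bigr (fun=> crg_weight c w true)); last first.
  by move=> e /andP[eS eG]; rewrite TE // eG.
rewrite sumr_const -[LHS]mulr_natl; congr (_ * _).
have SG : edges G \subset S.
  by apply/fintype.subsetP => e eG; rewrite inE (forall_inP (edgesP G)).
rewrite -card_draws -natrB ?subset_leq_card //; congr (_%:R).
rewrite -/S -[in X in (_ - X)%N](finset.setIidPr SG) -cardsD.
by apply: eq_card => e; rewrite !inE unfold_in inE andbC.
Qed.

Lemma crg_weight_ge0 (R : realType) (K : finType) (c : K -> K -> option bool)
    (w : K -> R) (b : bool) :
  (forall i, 0 <= w i) -> 0 <= crg_weight c w b.
Proof.
by move=> w0; apply: sumr_ge0 => i _; apply: sumr_ge0 => j _; rewrite !mulr_ge0.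
Qed.

(** * From CRGs to the edit distance function *)

(** The distance is at most the edit distance to each recolouring, hence at most the average. The
    last summand pays for the floor: there are fewer than [(1 - p) * 'C(n, 2) + 1] non-edges. *)
Lemma max_dist_le_crg (R : realType) (U K : finType) (F : sgraph U)
    (c : K -> K -> option bool) (w : K -> R) (p : R) (n : nat) :
  0 <= p <= 1 ->
  (forall i j, c i j = c j i) -> (forall i, 0 <= w i) -> \sum_i w i = 1 ->
  (forall g : U -> K,
     exists x y, x != y /\ c (g x) (g y) = Some (~~ adj F x y)) ->
  (max_dist (Forb F) p n)%:R <=
  'C(n, 2)%:R * (p * crg_weight c w false +
                 (1 - p) * crg_weight c w true) + crg_weight c w true.
Proof.
move=> /andP[p0 p1] cC w0 w1 cF.
have W0 := crg_weight_ge0 c false w0.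
have B0 := crg_weight_ge0 c true w0.
set W := crg_weight _ _ false in W0 *.
set B := crg_weight _ _ true in B0 *.
rewrite /max_dist; elim/big_ind: _ => [|a b ha hb|G /eqP EG].
- by rewrite addr_ge0 // mulr_ge0 // addr_ge0 // mulr_ge0 // subr_ge0.
- by rewrite /maxn; case: ifP.
have dist_le : (dist_to (Forb F) G)%:R <=
    #|edges G|%:R * W + ('C(n, 2)%:R - #|edges G|%:R) * B.
  have := expect_edit_dist G cC w1; rewrite card_ord => <-.
  have <- : \sum_(f : {ffun 'I_n -> K}) (\prod_v w (f v)) *
      (dist_to (Forb F) G)%:R = (dist_to (Forb F) G)%:R.
    by rewrite -mulr_suml sum_prod_weight // mul1r.
  apply: ler_sum => f _; apply: ler_wpM2l; first exact: prodr_ge0.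
  rewrite ler_nat; apply: dist_to_le_edit; exact: recolor_forb.
apply: (le_trans dist_le).
have Ele : #|edges G|%:R <= p * 'C(n, 2)%:R.
  by have := ge_floor (p * 'C(n, 2)%:R); rewrite -EG.
have Egt : p * 'C(n, 2)%:R < #|edges G|%:R + 1.
  by have := floorD1_gt (p * 'C(n, 2)%:R); rewrite -EG intrD.
have : 0 <= (p * 'C(n, 2)%:R - #|edges G|%:R) * W.
  by rewrite mulr_ge0 // subr_ge0.
have : 0 <= (#|edges G|%:R + 1 - p * 'C(n, 2)%:R) * B.
  by rewrite mulr_ge0 // subr_ge0 ltW.
lra.
Qed.

Lemma ed_le_crg (R : realType) (U K : finType) (F : sgraph U)
    (c : K -> K -> option bool) (w : K -> R) (p : R) :
  0 <= p <= 1 ->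
  (forall i j, c i j = c j i) -> (forall i, 0 <= w i) -> \sum_i w i = 1 ->
  (forall g : U -> K,
     exists x y, x != y /\ c (g x) (g y) = Some (~~ adj F x y)) ->
  ed (Forb F) p <=
  p * crg_weight c w false + (1 - p) * crg_weight c w true.
Proof.
move=> p01 cC w0 w1 cF.
have W0 := crg_weight_ge0 c false w0.
have B0 := crg_weight_ge0 c true w0.
have := fun n => max_dist_le_crg n p01 cC w0 w1 cF.
set W := crg_weight _ _ false in W0 *.
set B := crg_weight _ _ true in B0 *.
move=> Mle; rewrite /ed; set u := (fun n : nat => _).
(* A divergent sequence has limn equal to 0, so no proof of convergence is
   needed. *)
have [cu|/dvgP ->] := pselect (cvgn u); last first.
  by case/andP: p01 => p0 p1; rewrite addr_ge0 // mulr_ge0 // subr_ge0.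
apply/ler_addgt0Pr => e e0; apply: limr_le => //; near=> n.
have n2 : (2 <= n)%N by near: n; exact: nbhs_infty_ge.
(* Since [n - 1 <= 'C(n, 2)], the rounding term then contributes at most [e]. *)
have en : B / e <= n%:R - 1.
  by rewrite lerBrDr; near: n; exact: nbhs_infty_ger.
have Cn : n%:R - 1 <= 'C(n, 2)%:R :> R.
  rewrite lerBlDr natr1 ler_nat.
  by move: n2; case: (n) => [|[|m]] //= _; rewrite binS bin1; lia.
have C0 : 0 < 'C(n, 2)%:R :> R by rewrite ltr0n bin_gt0.
rewrite /u ler_pdivrMr //; apply: le_trans (Mle n) _.
rewrite [leRHS]mulrDl [X in _ <= X + _]mulrC lerD2l [leRHS]mulrC.
rewrite -ler_pdivrMr //.
exact: le_trans en Cn.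
Unshelve. all: by end_near.
Qed.

(** * CRGs with black vertices and gray or white edges *)

Definition gray_crg (T : eqType) (e : rel T) (x y : T) : option bool :=
  if x == y then Some true else if e x y then None else Some false.

Lemma adj_K2 (t : nat) (x y : 'I_2 + 'I_t) :
  adj (K2 t) x y =
  match x, y with inl _, inr _ | inr _, inl _ => true | _, _ => false end.
Proof.
rewrite /adj /= /K2_edges.
case: x y => [i|j] [i'|j']; apply/imset2P.
- by case=> a b _ _ /set2_inj[[]|[]].
- by exists i j'.
- by exists i' j => //; rewrite finset.setUC.
- by case=> a b _ _ /set2_inj[[]|[]].
Qed.

(* The images of the t vertices on the second side are distinct; each is a
   common neighbour of the images x and y of the first side or, only if x and y
   are adjacent, x or y itself. Hence the term (e x y).*2. *)
Lemma gray_crg_K2_free (t : nat) (T : finType) (e : rel T)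
    (g : 'I_2 + 'I_t -> T) :
  symmetric e ->
  (forall x y, x != y -> (#|[pred z | e x z && e y z]| + (e x y).*2 < t)%N) ->
  exists x y, x != y /\ gray_crg e (g x) (g y) = Some (~~ adj (K2 t) x y).
Proof.
move=> eC few; apply: contrapT => noxy.
have nadj x y : x != y -> ~~ adj (K2 t) x y -> g x != g y.
  move=> xy nxy; apply/negP => gxy; apply: noxy; exists x, y.
  by rewrite /gray_crg gxy (negbTE nxy).
have isadj x y : adj (K2 t) x y -> (g x == g y) || e (g x) (g y).
  move=> axy; have xy : x != y.
    by apply: contraTneq axy => ->; rewrite adj_irr.
  apply/negP => /negP; rewrite negb_or => /andP[/negbTE gxy /negbTE exy].
  by apply: noxy; exists x, y; rewrite /gray_crg gxy exy axy.
pose A := g (inl ord0); pose B := g (inl ord_max).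
have AB : A != B by apply: nadj; rewrite ?adj_K2.
have hI : injective (g \o inr).
  move=> i j /eqP; apply: contraTeq => ij.
  by apply: nadj; rewrite ?adj_K2.
have := few _ _ AB; rewrite ltnNge => /negP; apply.
rewrite -[X in (X <= _)%N]card_ord -(card_codom hI).
pose P := [pred z | e A z && e B z].
pose Q : seq T := if e A B then [:: A; B] else [::].
apply: (@leq_trans #|[predU P & mem Q]|); last first.
  apply: leq_trans (leq_addr #|[predI P & mem Q]| _) _.
  rewrite cardUI leq_add2l (leq_trans (card_size _)) // /Q.
  by case: (e A B).
apply/subset_leq_card/fintype.subsetP => _ /codomP[j ->] /=.
have := isadj (inl ord0) (inr j); have := isadj (inl ord_max) (inr j).
rewrite !adj_K2 => /(_ isT) hB /(_ isT) hA; rewrite !inE /Q.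
move: hA hB; rewrite -/A -/B.
case/orP => [/eqP<-|eA]; case/orP => [/eqP hB|eB].
- by rewrite hB eqxx in AB.
- by rewrite (eC A B) eB !inE eqxx orbT.
- by rewrite -hB in eA *; rewrite eA !inE eqxx !orbT.
- by rewrite eA eB.
Qed.

(** With weights 1/k the black probability is 1/k and the white one at most (k (k - 1) - D) / k^2.
    Bounding only the degree sum admits irregular graphs. *)
Lemma ed_K2_gray (R : realType) (p : R) (t k D : nat) (e : rel 'I_k) :
  0 <= p <= 1 -> (0 < k)%N -> symmetric e -> irreflexive e ->
  (D <= \sum_x #|e x|)%N ->
  (forall x y, x != y -> (#|[pred z | e x z && e y z]| + (e x y).*2 < t)%N) ->
  ed (Forb (K2 t)) p <= (1 + (k%:R - 2 - D%:R / k%:R) * p) / k%:R.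
Proof.
move=> p01 k0 eC eI deg few; have /andP[p0 p1] := p01.
have kR : 0 < k%:R :> R by rewrite ltr0n.
have cC i j : gray_crg e i j = gray_crg e j i.
  by rewrite /gray_crg eq_sym eC.
pose w (i : 'I_k) : R := k%:R^-1.
have w0 i : 0 <= w i by rewrite invr_ge0 ltW.
have w1 : \sum_i w i = 1.
  by rewrite sumr_const card_ord -[LHS]mulr_natl divff ?gt_eqF.
apply: le_trans (ed_le_crg p01 cC w0 w1 _) _.
  by move=> g; apply: gray_crg_K2_free.
have -> : crg_weight (gray_crg e) w true = k%:R^-1.
  have -> : k%:R^-1 = \sum_i w i * k%:R^-1 by rewrite -mulr_suml w1 mul1r.
  apply: eq_bigr => i _.
  rewrite (bigD1 i) //= big1 => [|j ji].
    by rewrite /gray_crg eqxx addr0 eqxx mulr1.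
  rewrite /gray_crg [i == j]eq_sym (negbTE ji).
  by case: (e i j); rewrite mulr0.
have row_false i : (\sum_j (gray_crg e i j == Some false) + #|e i| = k - 1)%N.
  have <- : (\sum_(j < k | j != i) 1 = k - 1)%N.
    rewrite sum1_card; have := cardC (pred1 i).
    by rewrite card1 card_ord => /(congr1 predn); rewrite add1n subn1 => <-.
  rewrite -sum1_card [X in (_ + X)%N]big_mkcond [RHS]big_mkcond -big_split /=.
  apply: eq_bigr => j _; rewrite /gray_crg eq_sym unfold_in.
  by have [->|_] := eqVneq j i; rewrite ?eI //; case: (e i j).
have W_le : crg_weight (gray_crg e) w false <=
    (k%:R - 1 - D%:R / k%:R) / k%:R.
  rewrite /crg_weight.
  have -> : \sum_i \sum_j w i * w j * (gray_crg e i j == Some false)%:R =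
      k%:R^-1 * k%:R^-1 *
      (\sum_i \sum_j (gray_crg e i j == Some false))%N%:R.
    rewrite natr_sum mulr_sumr; apply: eq_bigr => i _.
    by rewrite natr_sum mulr_sumr; apply: eq_bigr.
  have sumE : (\sum_(i < k) \sum_(j < k) (gray_crg e i j == Some false) +
               \sum_i #|e i| = k * (k - 1))%N.
    rewrite -big_split /= (eq_bigr (fun=> (k - 1)%N)) => [|i _] //.
    by rewrite sum_nat_const card_ord.
  have -> : (k%:R - 1 - D%:R / k%:R) / k%:R =
      k%:R^-1 * k%:R^-1 * (k%:R * (k%:R - 1) - D%:R) :> R.
    by field; rewrite gt_eqF.
  apply: ler_wpM2l; first by rewrite mulr_ge0.
  move/(congr1 (fun n => n%:R : R)): sumE; rewrite natrD natrM natrB // => <-.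
  by rewrite lerBrDr lerD2l ler_nat.
have := ler_wpM2l p0 W_le.
rewrite mulrA -[_ * k%:R^-1]/(_ / _) => pW.
apply: le_trans (lerD pW (lexx _)) _.
by rewrite -mulrDl ler_pM2r ?invr_gt0 //; lra.
Qed.

(** * A computable test on adjacency matrices *)

(** The hypotheses of [ed_K2_gray], phrased on lists so that [vm_compute] can decide them. *)
Definition gray_check (t k D : nat) (M : seq (seq bool)) : bool :=
  [&& (0 < k)%N, size M == k,
   all (fun r => size r == k) M, (D <= sumn [seq count id r | r <- M])%N &
   all (fun i => let r := nth [::] M i in
     all (fun j => let s := nth [::] M j in
       if i == j then ~~ nth false r j
       else (nth false s i == nth false r j) &&
         (count (fun b => b.1 && b.2) (zip r s) + (nth false r j).*2 < t)%N)
     (iota 0 k)) (iota 0 k)].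

Lemma card_count_nth (T : Type) (x0 : T) (P : pred T) (k : nat) (s : seq T) :
  size s = k -> #|[pred i : 'I_k | P (nth x0 s i)]| = count P s.
Proof.
move=> <-; rewrite -sum1_card -sum1_count (big_nth x0) big_mkord.
exact: eq_bigl.
Qed.

Lemma ed_K2_check (R : realType) (p : R) (t k D : nat) (M : seq (seq bool)) :
  0 <= p <= 1 -> gray_check t k D M ->
  ed (Forb (K2 t)) p <= (1 + (k%:R - 2 - D%:R / k%:R) * p) / k%:R.
Proof.
move=> p01 /and5P[k0 /eqP sM /allP rowsP deg /allP pairsP].
pose e (i j : 'I_k) := nth false (nth [::] M i) j.
have rowP (i : 'I_k) : size (nth [::] M i) = k.
  by apply/eqP/rowsP; rewrite mem_nth // sM.
have in_iota (i : 'I_k) : val i \in iota 0 k by rewrite mem_iota /=.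
have pairP (i j : 'I_k) := allP (pairsP i (in_iota i)) j (in_iota j).
have e_irr : irreflexive e.
  by move=> i; have := pairP i i; rewrite eqxx => /negbTE.
have {}pairP (i j : 'I_k) : i != j -> e j i = e i j /\
    (count (fun b => b.1 && b.2) (zip (nth [::] M i) (nth [::] M j)) +
       (e i j).*2 < t)%N.
  by move=> /negbTE ij; have := pairP i j; rewrite val_eqE ij => /andP[/eqP].
apply: (@ed_K2_gray R p t k D e) => // [i j||i j ij].
- by have [->//|/pairP[]] := eqVneq i j.
- apply: leq_trans deg _; rewrite sumnE big_map (big_nth [::]) sM big_mkord.
  by apply: leq_sum => i _; rewrite -(card_count_nth false id (rowP i)).
- have [_] := pairP _ _ ij; apply: leq_ltn_trans; rewrite leq_add2r.
  have szip : size (zip (nth [::] M i) (nth [::] M j)) = k.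
    by rewrite size_zip !rowP minnn.
  rewrite -(card_count_nth (false, false) _ szip) eq_leq //.
  by apply: eq_card => z; rewrite !inE nth_zip ?rowP.
Qed.

(** * The bound p (1 - p) *)

(** [K2 t] has no partition into a clique and an independent set: no side can have two black
    vertices, so each side has a white one, and these two are adjacent. *)
Lemma ed_K2_split (R : realType) (p : R) (t : nat) :
  0 <= p <= 1 -> (1 < t)%N -> ed (Forb (K2 t)) p <= p * (1 - p).
Proof.
move=> p01; case: t => [|[|t]] // _.
pose c (i j : bool) := if i == j then Some i else None.
(* These weights give p (1 - p)^2 + (1 - p) p^2 = p (1 - p). *)
pose w (i : bool) := if i then p else 1 - p.
have cC i j : c i j = c j i by rewrite /c eq_sym; case: eqP => // ->.
have w0 i : 0 <= w i.
  by case/andP: p01 => p0 p1; case: i => //; rewrite subr_ge0.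
have w1 : \sum_i w i = 1 by rewrite big_bool /=; lra.
apply: le_trans (ed_le_crg p01 cC w0 w1 _) _; last first.
  by rewrite /crg_weight !big_bool /c /w /=; lra.
move=> g; apply: contrapT => noxy.
have bad x y : x != y -> g x = g y -> g x = adj (K2 t.+2) x y.
  move=> xy gxy; have [//|/eqP gE] := eqVneq (g x) (adj (K2 t.+2) x y).
  case: noxy; exists x, y; rewrite /c gxy eqxx; split=> //; congr Some.
  by move: gE; rewrite gxy; case: (g y); case: adj.
have [i gi] : exists i, g (inl i) = false.
  case E0 : (g (inl ord0)); last by exists ord0.
  case E1 : (g (inl ord_max)); last by exists ord_max.
  by have := bad (inl ord0) (inl ord_max) isT; rewrite E0 E1 adj_K2 => /(_ erefl).
have [j gj] : exists j, g (inr j) = false.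
  case E0 : (g (inr ord0)); last by exists ord0.
  case E1 : (g (inr ord_max)); last by exists ord_max.
  by have := bad (inr ord0) (inr ord_max) isT; rewrite E0 E1 adj_K2 => /(_ erefl).
by have := bad (inl i) (inr j) isT; rewrite gi gj adj_K2 => /(_ erefl).
Qed.

(** * Constructions of the gray graphs *)

Local Open Scope nat_scope.

Definition adj_table (T : Type) (vs : seq T) (a : rel T) : seq (seq bool) :=
  [seq [seq a x y | y <- vs] | x <- vs].

(* Vertices (a, x) with a a block and x in Z_m1 x Z_m2; (a, x) is adjacent to
   (b, y) if y - x, encoded as d1 + m1 * d2, is in the (a, b) entry of S. *)
Definition block_cayley (m1 m2 : nat) (S : seq (seq (seq nat))) :
    seq (seq bool) :=
  adj_table
    [seq (a, x) | a <- iota 0 (size S),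
                  x <- [seq (x1, x2) | x1 <- iota 0 m1, x2 <- iota 0 m2]]
    (fun u v => let: (a, (x1, x2)) := u in let: (b, (y1, y2)) := v in
       ((y1 + (m1 - x1)) %% m1 + m1 * ((y2 + (m2 - x2)) %% m2))%N
         \in nth [::] (nth [::] S a) b).

Definition circulant (m : nat) (S : seq nat) := block_cayley 1 m [:: [:: S]].

Fixpoint vectors (q n : nat) : seq (seq nat) :=
  if n is n'.+1 then [seq x :: v | x <- iota 0 q, v <- vectors q n']
  else [:: [::]].

(* The collinearity graph of the generalized quadrangle W(q): points of
   PG(3, q), adjacent when orthogonal for a symplectic form. *)
Definition symplectic_graph (q : nat) (add mul : nat -> nat -> nat) :
    seq (seq bool) :=
  adj_table
    [seq v <- vectors q 4 | nth 0 [seq c <- v | c != 0] 0 == 1]%N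
    (fun u v => if (u, v) is ([:: x0; x1; x2; x3], [:: y0; y1; y2; y3]) then
       (u != v) && (add (mul x0 y1) (mul x2 y3) == add (mul x1 y0) (mul x3 y2))
     else false).

(** The elements of F_4 are 0, 1, 2 = a and 3 = a + 1, where a^2 = a + 1. In characteristic 2 sums
    serve as differences. *)
Definition addF4 (x y : nat) : nat :=
  nth 0%N (nth [::] [:: [:: 0; 1; 2; 3]; [:: 1; 0; 3; 2];
                        [:: 2; 3; 0; 1]; [:: 3; 2; 1; 0]] x) y.
Definition mulF4 (x y : nat) : nat :=
  nth 0%N (nth [::] [:: [:: 0; 0; 0; 0]; [:: 0; 1; 2; 3];
                        [:: 0; 2; 3; 1]; [:: 0; 3; 1; 2]] x) y.

(* Translates of the five lines of F_4^2 through 0, placed in an array along a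
   symmetric Latin square of order 6 whose sixth symbol is empty: McFarland's
   symmetric 2-(96,20,4) design with a polarity all of whose points are
   absolute. *)
Definition mcfarland_graph : seq (seq bool) :=
  adj_table [seq (a, v) | a <- iota 0 6, v <- vectors 4 2]
    (fun u v => if (u, v) is ((a, [:: x0; x1]), (b, [:: y0; y1])) then
       let d0 := addF4 x0 y0 in let d1 := addF4 x1 y1 in
       (u != v) && (match (a + b) %% 6 with
                    | 0 => d0 == 0%N
                    | 1 => false
                    | s.+2 => d1 == mulF4 s d0
                    end)%N
     else false).

(* The generalized quadrangle T_2^*(O) of order (3,5): vectors of F_4^3 whose
   difference is a multiple of a point of the hyperoval formed by the conic
   d1^2 = d0 d2 and its nucleus (0,1,0). *)
Definition hyperoval_graph : seq (seq bool) :=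
  adj_table (vectors 4 3)
    (fun u v => if (u, v) is ([:: x0; x1; x2], [:: y0; y1; y2]) then
       let d0 := addF4 x0 y0 in let d1 := addF4 x1 y1 in
       let d2 := addF4 x2 y2 in
       (u != v) && ((mulF4 d1 d1 == mulF4 d0 d2) || (d0 == 0) && (d2 == 0))%N
     else false).

(* The Ahrens-Szekeres generalized quadrangle AS(5) of order (4,6), with lines
   {(s,a,b)}, {(a,s,b)} and {(c s^2 - b s + a, - 2 c s + b, s)} indexed by
   a, b, c; eliminating a, b and c gives the equation below. *)
Definition ahrens_szekeres_graph : seq (seq bool) :=
  adj_table (vectors 5 3)
    (fun u v => if (u, v) is ([:: x0; x1; x2], [:: y0; y1; y2]) then
       (u != v) && ((x1 == y1) && (x2 == y2) ||
         (2 * x0 + x2 * (x1 + y1) == 2 * y0 + y2 * (x1 + y1) %[mod 5]))%N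
     else false).

Definition symplectic_mod (q : nat) : seq (seq bool) :=
  symplectic_graph q (fun x y => (x + y) %% q) (fun x y => (x * y) %% q).

(* Found by computer search. *)
Definition cayley_68 : seq (seq bool) := block_cayley 1 17
  [:: [:: [:: 1; 4; 13; 16]; [:: 1; 2; 8; 14; 15];
          [:: 0; 6; 8; 10; 16]; [:: 3; 5; 8; 11; 13]];
      [:: [:: 2; 3; 9; 15; 16]; [:: 2; 8; 9; 15];
          [:: 0; 3; 5; 12; 14]; [:: 0; 1; 4; 13; 16]];
      [:: [:: 0; 1; 7; 9; 11]; [:: 0; 3; 5; 12; 14];
          [:: 1; 4; 13; 16]; [:: 0; 6; 7; 10; 11]];
      [:: [:: 4; 6; 9; 12; 14]; [:: 0; 1; 4; 13; 16];
          [:: 0; 6; 7; 10; 11]; [:: 2; 8; 9; 15]]].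

(* Found by computer search; the degrees are 20 and 21, 1476 in total. *)
Definition cayley_72 : seq (seq bool) := block_cayley 2 6
  [:: [:: [:: 4; 8]; [:: 0; 3; 10]; [:: 1; 2; 3; 5; 9];
          [:: 1; 3; 10]; [:: 0; 2; 3; 4]; [:: 3; 5; 6]];
      [:: [:: 0; 2; 11]; [:: 4; 8]; [:: 0; 2; 3; 4];
          [:: 1; 2; 11]; [:: 6; 8; 11]; [:: 0; 4; 8; 10; 11]];
      [:: [:: 1; 5; 9; 10; 11]; [:: 0; 8; 10; 11]; [:: 1];
          [:: 2; 5; 7]; [:: 3; 4; 8; 10]; [:: 1; 5; 6; 11]];
      [:: [:: 1; 2; 11]; [:: 1; 3; 10]; [:: 7; 9; 10];
          [:: 4; 8]; [:: 0; 2; 3; 4; 8]; [:: 0; 8; 10; 11]];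
      [:: [:: 0; 8; 10; 11]; [:: 3; 4; 6]; [:: 2; 4; 8; 11];
          [:: 0; 4; 8; 10; 11]; [:: 1]; [:: 1; 5; 7; 10]];
      [:: [:: 6; 9; 11]; [:: 0; 2; 3; 4; 8]; [:: 1; 3; 6; 9];
          [:: 0; 2; 3; 4]; [:: 1; 2; 7; 9]; [:: 1]]].

(** * Verification of the graphs *)

(** Lets three of the graphs for t = 7 serve for t = 8 as well. *)
Lemma gray_check_leq (t t' k D : nat) (M : seq (seq bool)) :
  t <= t' -> gray_check t k D M -> gray_check t' k D M.
Proof.
move=> tt' /and5P[k0 sM rowsM deg pairsM]; apply/and5P; split => //.
apply: sub_all pairsM => i; apply: sub_all => j.
case: eqP => // _ /andP[sym lt_t]; apply/andP; split=> //.
exact: leq_trans lt_t tt'.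
Qed.

Lemma ed_K2_regular (R : realType) (p : R) (t k d : nat) (M : seq (seq bool)) :
  (0 <= p <= 1)%R -> gray_check t k (k * d) M ->
  (ed (Forb (K2 t)) p <= (1 + (k%:R - 2 - d%:R) * p) / k%:R)%R.
Proof.
move=> p01 chk; have /andP[k0 _] := chk.
have := ed_K2_check p01 chk.
by rewrite natrM mulrAC divff ?mul1r // pnatr_eq0 -lt0n.
Qed.

Lemma mcfarland_check : gray_check 5 96 (96 * 19) mcfarland_graph.
Proof. by vm_compute. Qed.

Lemma symplectic_3_check : gray_check 5 40 (40 * 12) (symplectic_mod 3).
Proof. by vm_compute. Qed.

Lemma paley_13_check :
  gray_check 5 13 (13 * 6) (circulant 13 [:: 1; 3; 4; 9; 10; 12]).
Proof. by vm_compute. Qed.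

(** Degree k - 2 makes the slope vanish, which gives the constant bound 1/6. *)
Lemma octahedron_check : gray_check 5 6 (6 * 4) (circulant 6 [:: 1; 2; 4; 5]).
Proof. by vm_compute. Qed.

Lemma symplectic_4_check :
  gray_check 6 85 (85 * 20) (symplectic_graph 4 addF4 mulF4).
Proof. by vm_compute. Qed.

(** The nonresidues and the residues modulo 13, joined by the planar difference set {0, 1, 5, 11}: a
    strongly regular graph with parameters (26,10,3,4). *)
Lemma bicirculant_26_check :
  gray_check 6 26 (26 * 10) (block_cayley 1 13
  [:: [:: [:: 2; 5; 6; 7; 8; 11]; [:: 0; 1; 5; 11]];
      [:: [:: 0; 2; 8; 12]; [:: 1; 3; 4; 9; 10; 12]]]).
Proof. by vm_compute. Qed.

Lemma paley_17_check :
  gray_check 6 17 (17 * 8) (circulant 17 [:: 1; 2; 4; 8; 9; 13; 15; 16]).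
Proof. by vm_compute. Qed.

Lemma petersen_complement_check :
  gray_check 6 10 (10 * 6) (block_cayley 1 5
  [:: [:: [:: 2; 3]; [:: 1; 2; 3; 4]]; [:: [:: 1; 2; 3; 4]; [:: 1; 4]]]).
Proof. by vm_compute. Qed.

Lemma symplectic_5_check : gray_check 7 156 (156 * 30) (symplectic_mod 5).
Proof. by vm_compute. Qed.

Lemma cayley_68_check : gray_check 7 68 (68 * 19) cayley_68.
Proof. by vm_compute. Qed.

Lemma hyperoval_check : gray_check 7 64 (64 * 18) hyperoval_graph.
Proof. by vm_compute. Qed.

(** Counting paths of length two, 14 * 13 = 14 * 4 + 21 * 6, so the bounds checked are tight and the
    graph is strongly regular with parameters (36,14,4,6). *)
Lemma cayley_36_check :
  gray_check 7 36 (36 * 14) (block_cayley 6 6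
  [:: [:: [:: 1; 2; 4; 5; 6; 7; 15; 17; 18; 21; 25; 27; 30; 35]]]).
Proof. by vm_compute. Qed.

Lemma rook_complement_check :
  gray_check 7 16 (16 * 9) (block_cayley 4 4
  [:: [:: [:: 5; 6; 7; 9; 10; 11; 13; 14; 15]]]).
Proof. by vm_compute. Qed.

Lemma cocktail_party_8_check :
  gray_check 7 8 (8 * 6) (circulant 8 [:: 1; 2; 3; 5; 6; 7]).
Proof. by vm_compute. Qed.

Lemma ahrens_szekeres_check : gray_check 8 125 (125 * 28) ahrens_szekeres_graph.
Proof. by vm_compute. Qed.

Lemma cayley_72_check : gray_check 8 72 1476 cayley_72.
Proof. by vm_compute. Qed.

(** The differences are the nonzero multiples of (1,0), (0,1) and (1,-1) in F_5^2. *)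
Lemma latin_square_25_check :
  gray_check 8 25 (25 * 12) (block_cayley 5 5
  [:: [:: [:: 1; 2; 3; 4; 5; 9; 10; 13; 15; 17; 20; 21]]]).
Proof. by vm_compute. Qed.

(** The differences form two of the three cosets of the cubes {1, 5, 8, 12} modulo 13. *)
Lemma circulant_13_check :
  gray_check 8 13 (13 * 8) (circulant 13 [:: 1; 2; 3; 5; 8; 10; 11; 12]).
Proof. by vm_compute. Qed.

(** In the complete graph on t - 1 vertices two vertices have t - 3 common neighbours, and t - 3 + 2
    < t; the line is (1 - p) / (t - 1). *)
Lemma complete_check (t : nat) : t \in [:: 5; 6; 7; 8] ->
  gray_check t t.-1 (t.-1 * t.-2) (circulant t.-1 (iota 1 t.-2)).
Proof. by rewrite !inE => /or4P[]/eqP->; vm_compute. Qed.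

Local Open Scope ring_scope.

Theorem theorem12 (R : realType) (p : R) (hp : 0 <= p <= 1) :
  [/\ ed (Forb (K2 5)) p <=
        \big[Num.min/p * (1 - p)]_(x <-
          [:: (1 + 75 * p) / 96; (1 + 26 * p) / 40; (1 + 5 * p) / 13;
              1 / 6; (1 - p) / 4]) x,
      ed (Forb (K2 6)) p <=
        \big[Num.min/p * (1 - p)]_(x <-
          [:: (1 + 63 * p) / 85; (1 + 14 * p) / 26; (1 + 7 * p) / 17;
              (1 + 2 * p) / 10; (1 - p) / 5]) x,
      ed (Forb (K2 7)) p <=
        \big[Num.min/p * (1 - p)]_(x <-
          [:: (1 + 124 * p) / 156; (1 + 76 * p) / 100; (1 + 44 * p) / 64;
              (1 + 31 * p) / 49; (1 + 20 * p) / 36; (1 + 5 * p) / 16;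
              1 / 8; (1 - p) / 6]) x
    & ed (Forb (K2 8)) p <=
        \big[Num.min/p * (1 - p)]_(x <-
          [:: (1 + 124 * p) / 156; (1 + 95 * p) / 125; (1 + 53 * p) / 76;
              (1 + 20 * p) / 36; (1 + 11 * p) / 25; (1 + 5 * p) / 16;
              (3 * p + 1) / 13; (1 - p) / 7]) x].
Proof.
have /andP[p0 p1] := hp.
(* The default value p (1 - p) of each minimum becomes the last conjunct. *)
split; rewrite !big_cons big_nil !le_min (ed_K2_split hp) // andbT.
- have := ed_K2_regular hp mcfarland_check.
  have := ed_K2_regular hp symplectic_3_check.
  have := ed_K2_regular hp paley_13_check.
  have := ed_K2_regular hp octahedron_check.
  have /= := ed_K2_regular hp (@complete_check 5 isT).
  by move=> ? ? ? ? ?; repeat (apply/andP; split); lra.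
- have := ed_K2_regular hp symplectic_4_check.
  have := ed_K2_regular hp bicirculant_26_check.
  have := ed_K2_regular hp paley_17_check.
  have := ed_K2_regular hp petersen_complement_check.
  have /= := ed_K2_regular hp (@complete_check 6 isT).
  by move=> ? ? ? ? ?; repeat (apply/andP; split); lra.
- have := ed_K2_regular hp symplectic_5_check.
  (* The convex combination of this line and that of 36 vertices with constant term 1/49 has slope
     below 31/49. *)
  have := ed_K2_regular hp cayley_68_check.
  have := ed_K2_regular hp hyperoval_check.
  have := ed_K2_regular hp cayley_36_check.
  have := ed_K2_regular hp rook_complement_check.
  have := ed_K2_regular hp cocktail_party_8_check.
  have /= := ed_K2_regular hp (@complete_check 7 isT).
  by move=> ? ? ? ? ? ? ?; repeat (apply/andP; split); lra.
- have := ed_K2_regular hp (gray_check_leq (leqnSn 7) symplectic_5_check).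
  have := ed_K2_regular hp ahrens_szekeres_check.
  (* The convex combination of this line and that of 125 vertices with constant term 1/76 has slope
     below 53/76. *)
  have := ed_K2_check hp cayley_72_check.
  have := ed_K2_regular hp (gray_check_leq (leqnSn 7) cayley_36_check).
  have := ed_K2_regular hp latin_square_25_check.
  have := ed_K2_regular hp (gray_check_leq (leqnSn 7) rook_complement_check).
  have := ed_K2_regular hp circulant_13_check.
  have /= := ed_K2_regular hp (@complete_check 8 isT).
  by move=> ? ? ? ? ? ? ? ?; repeat (apply/andP; split); lra.
Qed.
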